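(* Let $n$ be an odd positive integer and let $F(X)=X^{21}$ over $\mathbb{F}_{2^n}$. Then for $a,b\in\mathbb{F}_{2^n}$, $$\nabla_F(a,b)=\begin{cases} 2^n & \text{if } ab=0 \text{ or } a=b,\\ 4 & \text{if } ab\neq 0,\ a\neq b,\ \displaystyle\sum_{i=0}^{n-1}v^{s_i}C^{2^{2i}}=0 \text{ and } \displaystyle\sum_{r=0}^{n-1}\left(\sum_{i=0}^{n-1}(i+1)v^{s_i}C^{2^{2i}}\right)^{2^{2r}}=0,\\ 0 & \text{otherwise,} \end{cases}$$ where, for $ab\neq 0$ and $a\neq b$, $v=\left(\dfrac{b}{a}\left(1+\dfrac{b^3}{a^3}\right)\right)^3$, $C=1+\dfrac{b^{20}+a^4b^{16}+a^{15}b^5+a^3b^{17}}{a^{16}b^4+a^{19}b}$, $s_i=\sum_{j=i}^{n-2}2^{2(j+1)}$ for $0\leq i\leq n-2$, and $s_{n-1}=0$. Moreover, the Feistel boomerang uniformity of $F$ is $4$.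
   Context: For $F:\mathbb{F}_{2^n}\to\mathbb{F}_{2^n}$ and $a,b\in\mathbb{F}_{2^n}$, set $\nabla_F(a,b)=\#\{X\in\mathbb{F}_{2^n}: F(X+a+b)+F(X+b)+F(X+a)+F(X)=0\}$. The Feistel boomerang uniformity (equivalently, the second-order zero differential uniformity) of $F$ is $\max\{\nabla_F(a,b): a,b\in\mathbb{F}_{2^n}\setminus\{0\},\ a\neq b\}$. The integer coefficients $(i+1)$ are interpreted in $\mathbb{F}_{2^n}$, i.e. modulo $2$.
   Formalization: The claim that the Feistel boomerang uniformity is 4 is stated only for odd n other than 1 and 5: for n = 1 there are no nonzero distinct a, b, and for n = 5 the function X^21 is APN, so its uniformity is 0. *)

(* Defs.v *)
From HB Require Import structures.
From mathcomp Require Import all_boot all_order all_algebra.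

Set Implicit Arguments.
Unset Strict Implicit.
Unset Printing Implicit Defensive.

Import GRing.Theory.
Local Open Scope ring_scope.

Definition nabla (K : finFieldType) (F : K -> K) (a b : K) : nat :=
  #|[set X : K | F (X + a + b) + F (X + b) + F (X + a) + F X == 0]|.

(* The maximum over an empty range of pairs is 0; in characteristic 2 the range
   is empty only for the field with two elements. *)
Definition feistel_boomerang_uniformity (K : finFieldType) (F : K -> K) : nat :=
  \max_(p : K * K | [&& p.1 != 0, p.2 != 0 & p.1 != p.2]) nabla F p.1 p.2.

Definition vcoef (K : finFieldType) (a b : K) : K :=
  (b / a * (1 + b ^+ 3 / a ^+ 3)) ^+ 3.

Definition Ccoef (K : finFieldType) (a b : K) : K :=
  1 + (b ^+ 20 + a ^+ 4 * b ^+ 16 + a ^+ 15 * b ^+ 5 + a ^+ 3 * b ^+ 17)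
      / (a ^+ 16 * b ^+ 4 + a ^+ 19 * b).

(* j ranges over i, ..., n - 2; for i = n - 1 the range is empty and the
   exponent is 0. *)
Definition sexp (n i : nat) : nat :=
  (\sum_(i <= j < n.-1) 2 ^ (2 * j.+1))%N.

(* Main.v *)
Require Import Defs.
From HB Require Import structures.
From mathcomp Require Import all_boot all_order all_algebra.
From mathcomp Require Import all_field ring zify.

Set Implicit Arguments.
Unset Strict Implicit.
Unset Printing Implicit Defensive.

Import GRing.Theory.
Local Open Scope ring_scope.

(** Scale to a = 1. Since X^21 = X^16 X^4 X is trilinear, its second derivative in
the directions 1 and b is d Y^4 + d^4 Y + c with Y = X + X^4 and d = b + b^4.
Putting Y = d W and R = c / d^5 leaves the two equations W + W^4 = R and
X + X^4 = d W. As n is odd, Z + Z^4 = r is solvable iff Tr r = 0, with an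
explicit root, and a nonempty solution set is a coset of {0, 1, b, b + 1}. The
two conditions of the formula become Tr R = 0 and Tr (b^4 R) = 0.

For the maximum one needs some b satisfying both. The maps b -> 1/b and
b -> b + 1 permute the conditions Tr R = 0, Tr (b^4 R) = 0 and
Tr ((1 + b^4) R) = 0; if no b works they are pairwise exclusive, so each of them
holds for a third of the b, and a certain rational function g(b) of low degree
has trace 0 for two thirds of the b. For n >= 13 this contradicts a Stepanov
type bound: with m = 7 and Q = 2^(n-7), a pigeonhole choice of coefficients gives
a nonzero polynomial of degree at most 84.5 Q + 14 < (2/3)(2^n - 2) vanishing at
every such b. For n = 3, 7, 9, 11 explicit solutions are given. *)

(** * Univariate polynomial identities in characteristic two *)

(** [ring] cannot use 2 = 0, so one-variable identities in characteristic two are reified and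
    decided on lists of bits, lowest degree first. *)
Inductive f2expr : Type :=
| F2X | F2zero | F2one
| F2opp of f2expr
| F2add of f2expr & f2expr
| F2mul of f2expr & f2expr
| F2exp of f2expr & nat.

Fixpoint f2eval (R : comNzRingType) (x : R) (e : f2expr) : R :=
  match e with
  | F2X => x
  | F2zero => 0
  | F2one => 1
  | F2opp e1 => - f2eval x e1
  | F2add e1 e2 => f2eval x e1 + f2eval x e2
  | F2mul e1 e2 => f2eval x e1 * f2eval x e2
  | F2exp e1 k => f2eval x e1 ^+ k
  end.

Fixpoint bits_add (s t : seq bool) : seq bool :=
  match s, t with
  | [::], _ => t
  | _, [::] => s
  | a :: s', b :: t' => addb a b :: bits_add s' t'
  end.

Fixpoint bits_mul (s t : seq bool) : seq bool :=
  if s is a :: s' then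
    let r := false :: bits_mul s' t in if a then bits_add t r else r
  else [::].

Fixpoint f2norm (e : f2expr) : seq bool :=
  match e with
  | F2X => [:: false; true]
  | F2zero => [::]
  | F2one => [:: true]
  | F2opp e1 => f2norm e1
  | F2add e1 e2 => bits_add (f2norm e1) (f2norm e2)
  | F2mul e1 e2 => bits_mul (f2norm e1) (f2norm e2)
  | F2exp e1 k => let s := f2norm e1 in iter k (bits_mul s) [:: true]
  end.

Fixpoint bits_eval (R : comNzRingType) (x : R) (s : seq bool) : R :=
  if s is a :: s' then (a : nat)%:R + x * bits_eval x s' else 0.

Section Char2Reflection.

Variables (R : comNzRingType) (R2 : 2 \in [pchar R]) (x : R).

Lemma bits_evalD s t :
  bits_eval x (bits_add s t) = bits_eval x s + bits_eval x t.
Proof.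
elim: s t => [|a s IH] [|b t] /=; rewrite ?add0r ?addr0 // IH.
have -> : (addb a b : nat)%:R = (a : nat)%:R + (b : nat)%:R :> R.
  by case: a b => [] [] /=; rewrite ?add0r ?addr0 ?(addrr_pchar2 R2).
ring.
Qed.

Lemma bits_evalM s t :
  bits_eval x (bits_mul s t) = bits_eval x s * bits_eval x t.
Proof.
elim: s => [|a s IH] /=; first by rewrite mul0r.
by case: a => /=; rewrite ?bits_evalD /= IH; ring.
Qed.

Lemma f2normE e : bits_eval x (f2norm e) = f2eval x e.
Proof.
elim: e => //= [|| e1 ->|e1 <- e2 <-|e1 <- e2 <-|e1 IH k].
- by rewrite mulr0 addr0 mulr1 add0r.
- by rewrite mulr0 addr0.
- by rewrite (oppr_pchar2 R2).
- exact: bits_evalD.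
- exact: bits_evalM.
- by elim: k => /= [|k IHk]; rewrite ?mulr0 ?addr0 // bits_evalM IHk IH exprS.
Qed.

Lemma bits_eval0 s : ~~ has id s -> bits_eval x s = 0.
Proof. by elim: s => //= -[] //= s IH /IH->; rewrite mulr0 addr0. Qed.

Lemma f2eval_eq e1 e2 :
  ~~ has id (f2norm (F2add e1 e2)) -> f2eval x e1 = f2eval x e2.
Proof.
move=> /bits_eval0; rewrite f2normE /= => /eqP.
by rewrite addr_eq0 (oppr_pchar2 R2) => /eqP.
Qed.

End Char2Reflection.

Ltac f2reify x t :=
  lazymatch t with
  | x => constr:(F2X)
  | 0%R => constr:(F2zero)
  | 1%R => constr:(F2one)
  | (- ?a)%R => let ea := f2reify x a in constr:(F2opp ea)
  | (?a + ?b)%R =>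
      let ea := f2reify x a in let eb := f2reify x b in constr:(F2add ea eb)
  | (?a * ?b)%R =>
      let ea := f2reify x a in let eb := f2reify x b in constr:(F2mul ea eb)
  | (?a ^+ ?k)%R => let ea := f2reify x a in constr:(F2exp ea k)
  end.

Ltac f2ring R2 x :=
  lazymatch goal with
  | |- ?a = ?b =>
      let ea := f2reify x a in let eb := f2reify x b in
      exact: (@f2eval_eq _ R2 x ea eb isT)
  end.

(** * Traces on a finite field of odd degree over F_2 *)

Section OddDegree.

Variables (n : nat) (K : finFieldType).
Hypotheses (n_odd : odd n) (cardK : #|K| = (2 ^ n)%N).

Let n_gt0 : (0 < n)%N. Proof. by case: n n_odd. Qed.

Lemma pchar2K : 2 \in [pchar K].
Proof. exact: card_finPcharP cardK _. Qed.
Let K2 := pchar2K.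

Let addKK (x : K) : x + x = 0. Proof. exact: addrr_pchar2 K2 x. Qed.
Let oppK (x : K) : - x = x. Proof. exact: oppr_pchar2 K2 x. Qed.

Lemma addr_eq0_pchar2 (x y : K) : (x + y == 0) = (x == y).
Proof. by rewrite addr_eq0 oppK. Qed.

Lemma frob2D k (x y : K) : (x + y) ^+ (2 ^ k) = x ^+ (2 ^ k) + y ^+ (2 ^ k).
Proof. by apply: exprDn_pchar; rewrite pnatX (pnatE _ (pcharf_prime K2)) K2. Qed.

Lemma frob2_sum k (I : Type) (r : seq I) (P : pred I) (E : I -> K) :
  (\sum_(i <- r | P i) E i) ^+ (2 ^ k) = \sum_(i <- r | P i) E i ^+ (2 ^ k).
Proof.
by apply: (big_morph (fun x : K => x ^+ (2 ^ k)) (frob2D k)); rewrite expr0n expn_eq0.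
Qed.

Lemma expK_card (x : K) : x ^+ (2 ^ n) = x.
Proof. by rewrite -cardK expf_card. Qed.

Definition tr2 (x : K) : K := \sum_(i < n) x ^+ (2 ^ i).

Definition tr4 (x : K) : K := \sum_(i < n) x ^+ (2 ^ (2 * i)).

Lemma tr2D x y : tr2 (x + y) = tr2 x + tr2 y.
Proof. by rewrite /tr2 -big_split; apply: eq_bigr => i _; exact: frob2D. Qed.

Lemma tr2_sqr x : tr2 (x ^+ 2) = tr2 x.
Proof.
rewrite /tr2; case: (n) n_gt0 expK_card => // m _ EK.
rewrite big_ord_recr big_ord_recl /= expn0 expr1 -exprM -expnS EK addrC.
by congr (_ + _); apply: eq_bigr => i _; rewrite -exprM -expnS.
Qed.

Lemma tr2_frob k x : tr2 (x ^+ (2 ^ k)) = tr2 x.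
Proof.
by elim: k => [|k IH]; rewrite ?expr1 // expnSr exprM tr2_sqr.
Qed.

Lemma sqr_tr2 x : tr2 x ^+ 2 = tr2 x.
Proof.
rewrite -[RHS]tr2_sqr /tr2 -[X in _ ^+ X]expn1 frob2_sum.
by apply: eq_bigr => i _; rewrite -!exprM mulnC.
Qed.

Lemma tr2_01 x : (tr2 x == 0) || (tr2 x == 1).
Proof.
have: tr2 x * (tr2 x - 1) == 0 by rewrite mulrBr mulr1 -expr2 sqr_tr2 subrr.
by rewrite mulf_eq0 subr_eq0.
Qed.

Lemma natrK_odd m : m%:R = (odd m)%:R :> K.
Proof.
by rewrite -[in LHS](odd_double_half m) natrD -muln2 natrM (pcharf0 K2) mulr0 addr0.
Qed.

Lemma tr2_fixed x : x ^+ 2 = x -> tr2 x = x.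
Proof.
move=> x2; have xk k : x ^+ (2 ^ k) = x.
  by elim: k => [|k IH]; rewrite ?expr1 // expnSr exprM IH.
rewrite /tr2 (eq_bigr (fun=> x)) // sumr_const card_ord -mulr_natr.
by rewrite natrK_odd n_odd mulr1.
Qed.

(* As n is odd, 4 generates the same Galois group as 2. *)
Lemma tr4E x : tr4 x = tr2 x.
Proof.
have s2 : tr4 x ^+ 2 = tr4 x.
  apply/eqP; rewrite -addr_eq0_pchar2 /tr4 -[X in _ ^+ X]expn1 frob2_sum.
  (* Even and odd exponents interleave to all i < 2n, which is twice the trace and hence 0. *)
  have -> : \sum_(i < n) x ^+ (2 ^ (2 * i)) ^+ (2 ^ 1) + \sum_(i < n) x ^+ (2 ^ (2 * i))
      = \sum_(0 <= i < n + n) x ^+ (2 ^ i).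
    rewrite addrC addnn; elim: (n) => [|m IH]; first by rewrite !big_ord0 big_geq // addr0.
    rewrite doubleS !big_nat_recr //= -IH !big_ord_recr /= -exprM -expnD mul2n addn1.
    ring.
  rewrite (big_cat_nat (n := n)) ?leq_addr //= big_mkord -[X in _ + \sum_(X <= i < _) _]add0n.
  rewrite big_addn addnK big_mkord.
  rewrite [X in _ + X](eq_bigr (fun i : 'I_n => x ^+ (2 ^ i))) ?addKK // => i _.
  by rewrite addnC expnD exprM expK_card.
rewrite -[LHS](tr2_fixed s2) /tr4.
rewrite (big_morph tr2 tr2D (tr2_fixed (expr0n _ _))).
rewrite (eq_bigr (fun=> tr2 x)) => [|i _]; last exact: tr2_frob.
by rewrite sumr_const card_ord -mulr_natr natrK_odd n_odd mulr1.
Qed.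

Lemma tr2_1 : tr2 1 = 1. Proof. by rewrite tr2_fixed ?expr1n. Qed.

Lemma tr2_eq0_addr1 x : (tr2 (1 + x) == 0) = (tr2 x != 0).
Proof.
rewrite tr2D tr2_1 addr_eq0_pchar2; case/orP: (tr2_01 x) => /eqP->.
  by rewrite eqxx oner_eq0.
by rewrite eqxx oner_eq0.
Qed.

(** * The equation Z + Z^4 = R *)

(** In Z + Z^4 the coefficients i + 1 and i of r^(4^i) add up to 1 modulo 2, which gives the trace;
    the last term wraps around to n r^(4^n) = r. *)
Definition quartic_root (r : K) : K := \sum_(i < n) i.+1%:R * r ^+ (2 ^ (2 * i)).

Lemma quartic_rootP r :
  quartic_root r + quartic_root r ^+ 4 = r + tr2 r.
Proof.
rewrite -tr4E /quartic_root /tr4 -[X in _ ^+ X]/(2 ^ 2)%N frob2_sum.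
have fz (i : 'I_n) : (i.+1%:R * r ^+ (2 ^ (2 * i))) ^+ (2 ^ 2)
    = i.+1%:R * r ^+ (2 ^ (2 * i.+1)).
  rewrite exprMn -exprM -expnD addnC mulnS natrK_odd; congr (_ * _).
  by case: odd; rewrite ?expr1n ?expr0n.
rewrite (eq_bigr _ (fun i _ => fz i)) addrC => {fz}.
suff -> : \sum_(i < n) i.+1%:R * r ^+ (2 ^ (2 * i.+1)) =
    n%:R * r ^+ (2 ^ (2 * n)) + \sum_(i < n) i%:R * r ^+ (2 ^ (2 * i)).
  rewrite -addrA -big_split natrK_odd n_odd mul1r mul2n -addnn expnD exprM !expK_card.
  congr (_ + _); apply: eq_bigr => i _ /=.
  by rewrite -natr1 mulrDl mul1r addrA addKK add0r.
elim: (n) => [|m IH]; first by rewrite !big_ord0 mul0r addr0.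
by rewrite 2!big_ord_recr /= IH; ring.
Qed.

Lemma tr2_x4 x : tr2 (x ^+ 4) = tr2 x.
Proof. exact: (tr2_frob 2). Qed.

Lemma quartic_solvable r : tr2 r = 0 -> exists z, z + z ^+ 4 = r.
Proof. by move=> r0; exists (quartic_root r); rewrite quartic_rootP r0 addr0. Qed.

Lemma quartic_tr2 z : tr2 (z + z ^+ 4) = 0.
Proof. by rewrite tr2D tr2_x4 addKK. Qed.

(** Such an x lies in F_4, which meets a field of odd degree in F_2: x = x^(2^n) collapses to
    x^2. *)
Lemma x4_fixed (x : K) : x ^+ 4 = x -> (x == 0) || (x == 1).
Proof.
move=> x4; have xk k : x ^+ (2 ^ (k.*2)) = x.
  by elim: k => [|k IH]; rewrite ?expr1 // doubleS !expnSr -mulnA exprM IH.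
have: x * (x - 1) == 0; last by rewrite mulf_eq0 subr_eq0.
rewrite mulrBr mulr1 -expr2 -[X in _ - X]expK_card -[n]odd_double_half n_odd.
by rewrite expnD exprM [in X in _ - X]exprAC xk expn1 subrr.
Qed.

(** * Second-order derivatives of X^21 *)

Definition ddiff21 (x b : K) : K :=
  (x + 1 + b) ^+ 21 + (x + b) ^+ 21 + (x + 1) ^+ 21 + x ^+ 21.

Definition dcoef (b : K) : K := b + b ^+ 4.

(** The constant term [ddiff21 0 b], expanded in characteristic two. *)
Definition ccoef (b : K) : K :=
  b + b ^+ 4 + b ^+ 16 + b ^+ 5 + b ^+ 17 + b ^+ 20.

Definition rcoef (b : K) : K := ccoef b / dcoef b ^+ 5.

Lemma exp21D (x y : K) :
  (x + y) ^+ 21 = (x ^+ 16 + y ^+ 16) * (x ^+ 4 + y ^+ 4) * (x + y).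
Proof.
by rewrite -(frob2D 4) -(frob2D 2) -exprD -exprSr.
Qed.

(* X^21 is the trilinear form X^16 X^4 X on the diagonal. *)
Lemma ddiff21E x b :
  ddiff21 x b = dcoef b * (x + x ^+ 4) ^+ 4 + dcoef b ^+ 4 * (x + x ^+ 4) + ccoef b.
Proof.
have f4 (y z : K) : (y + z) ^+ 4 = y ^+ 4 + z ^+ 4 by exact: (frob2D 2).
have f16 (y z : K) : (y + z) ^+ 16 = y ^+ 16 + z ^+ 16 by exact: (frob2D 4).
(* With alternating signs the second difference cancels already over the integers; the right-hand
   side then exceeds it only by 2 b^4 x^4, which is supplied by hand for [ring]. *)
rewrite /ddiff21 -[(x + b) ^+ 21]oppK -[(x + 1) ^+ 21]oppK.
rewrite /dcoef /ccoef !exp21D !f4 !f16 !expr1n -!exprM /=.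
apply/esym/eqP; rewrite -subr_eq0 -(addKK (b ^+ 4 * x ^+ 4)) -subr_eq0; apply/eqP.
ring.
Qed.

Section Solutions.

Variable b : K.
Hypotheses (b0 : b != 0) (b1 : b != 1).

Let d := dcoef b.

Lemma dcoef_neq0 : d != 0.
Proof.
apply/negP; rewrite /d /dcoef addr_eq0_pchar2 => /eqP/esym/x4_fixed.
by rewrite (negPf b0) (negPf b1).
Qed.

(** The two arguments differ by b z + (b z)^4, of trace 0. So the solvability of X + X^4 = d W
    depends only on R = W + W^4, not on the chosen root W. *)
Lemma tr2_mul_dcoef z : tr2 (d * z) = tr2 (b ^+ 4 * (z + z ^+ 4)).
Proof.
have -> : d * z = b ^+ 4 * (z + z ^+ 4) + (b * z + (b * z) ^+ 4).
  rewrite /d /dcoef; apply/eqP; rewrite -subr_eq0 -[LHS in LHS == _]addr0.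
  by rewrite -{1}(addKK (b ^+ 4 * z ^+ 4)); apply/eqP; ring.
by rewrite tr2D quartic_tr2 addr0.
Qed.

Lemma ddiff21_eq0 x w : x + x ^+ 4 = d * w ->
  (ddiff21 x b == 0) = (w + w ^+ 4 == rcoef b).
Proof.
move=> xw; rewrite ddiff21E xw /rcoef.
have d5 : d ^+ 5 != 0 by rewrite expf_neq0 // dcoef_neq0.
rewrite addr_eq0_pchar2 -[RHS](can_eq (mulfK d5)) divfK //; congr (_ == _).
by rewrite -/d; ring.
Qed.

Lemma ddiff21_solvable : (exists x, ddiff21 x b = 0) <->
  tr2 (rcoef b) = 0 /\ tr2 (b ^+ 4 * rcoef b) = 0.
Proof.
split=> [[x /eqP xb0]|[r0 br0]].
  have xw : x + x ^+ 4 = d * ((x + x ^+ 4) / d) by rewrite mulrC divfK ?dcoef_neq0.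
  move: xb0; rewrite (ddiff21_eq0 xw) => /eqP wr.
  by rewrite -wr quartic_tr2 -tr2_mul_dcoef -xw quartic_tr2.
have [w wr] := quartic_solvable r0.
have [|x xw] := quartic_solvable (r := d * w); first by rewrite tr2_mul_dcoef wr.
by exists x; apply/eqP; rewrite (ddiff21_eq0 xw) wr.
Qed.

(** The difference v of two solutions satisfies d Y^4 + d^4 Y = 0 with Y = v + v^4, so Y / d is 0 or
    1. Then v, respectively v + b, is fixed by the fourth power. *)
Lemma ddiff21_solutions x : ddiff21 x b = 0 ->
  [set y | ddiff21 y b == 0] = [set x; x + 1; x + b; x + b + 1].
Proof.
move=> xb0; apply/setP => y; rewrite !inE.
have -> : y = x + (y + x) by rewrite addrCA addKK addr0.
move: (y + x) => v {y}.
have ex u : (x + v == x + u) = (v == u) by exact: (inj_eq (addrI x)).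
have -> : (x + v == x) = (v == 0) by rewrite -[X in _ == X]addr0 ex.
rewrite -(addrA x b) !ex.
have -> : (ddiff21 (x + v) b == 0) =
    (d * (v + v ^+ 4) ^+ 4 + d ^+ 4 * (v + v ^+ 4) == 0).
  rewrite -[X in _ = (X == 0)]add0r -xb0 !ddiff21E -/d; congr (_ == _).
  by rewrite !(frob2D 2); ring.
have -> : d * (v + v ^+ 4) ^+ 4 + d ^+ 4 * (v + v ^+ 4) =
    d ^+ 5 * ((v + v ^+ 4) / d + ((v + v ^+ 4) / d) ^+ 4).
  by field; exact: dcoef_neq0.
have fix4 (z : K) : (z + z ^+ 4 == 0) = (z == 0) || (z == 1).
  apply/idP/orP; first by rewrite addr_eq0_pchar2 eq_sym => /eqP/x4_fixed/orP.
  by case=> /eqP->; rewrite ?expr0n ?expr1n ?addr0 ?addKK.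
rewrite mulf_eq0 expf_eq0 (negPf dcoef_neq0) andbF orFb fix4.
rewrite mulf_eq0 invr_eq0 (negPf dcoef_neq0) orbF fix4 -!orbA; congr [|| _, _ | _].
have -> : ((v + v ^+ 4) / d == 1) = (v + b + (v + b) ^+ 4 == 0).
  rewrite -[RHS](can_eq (mulfK (invr_neq0 dcoef_neq0))) mul0r.
  have -> : v + b + (v + b) ^+ 4 = v + v ^+ 4 + d by rewrite (frob2D 2) addrACA.
  rewrite (mulrDl (v + v ^+ 4) d d^-1) (divff dcoef_neq0).
  by rewrite addr_eq0_pchar2.
by rewrite fix4 addr_eq0_pchar2 -[X in _ || X]addr_eq0_pchar2 -addrA addr_eq0_pchar2.
Qed.

Lemma card_ddiff21 :
  #|[set x | ddiff21 x b == 0]| =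
    if (tr2 (rcoef b) == 0) && (tr2 (b ^+ 4 * rcoef b) == 0) then 4 else 0.
Proof.
case: ifPn => [/andP[/eqP r0 /eqP br0]|nr].
  have [x /ddiff21_solutions->] := ddiff21_solvable.2 (conj r0 br0).
  set t := [:: x; x + 1; x + b; x + b + 1].
  have -> : [set x; x + 1; x + b; x + b + 1] = [set y in t].
    by apply/setP=> y; rewrite !inE -!orbA.
  rewrite cardsE; apply/card_uniqP => /=.
  have ex0 u : (x == x + u) = (u == 0).
    by rewrite -[X in X == _]addr0 (inj_eq (addrI x)) eq_sym.
  have e1 : (1 == b + 1) = (b == 0).
    by rewrite addrC -subr_eq0 opprD addrA subrr add0r oppr_eq0.
  have eb : (b == b + 1) = false.
    by rewrite -subr_eq0 opprD addrA subrr add0r oppr_eq0 oner_eq0.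
  rewrite !inE -(addrA x b) !ex0 !(inj_eq (addrI x)) e1 eb addr_eq0_pchar2.
  by rewrite oner_eq0 (eq_sym 1) (negPf b0) (negPf b1).
apply: eq_card0 => x; rewrite !inE; apply/negP => /eqP xb0.
have [/eqP r0 /eqP br0] := ddiff21_solvable.1 (ex_intro _ x xb0).
by rewrite r0 br0 in nr.
Qed.

End Solutions.

(** * From the trace conditions to the sums of the formula *)

Lemma sexp3 i : (i < n)%N -> (3 * sexp n i + 2 ^ (2 * i.+1) = 2 ^ (2 * n))%N.
Proof.
rewrite /sexp; case: n n_gt0 => // m _; rewrite ltnS /=.
elim: m => [|m IH]; first by rewrite leqn0 => /eqP->; rewrite big_geq.
rewrite leq_eqVlt => /orP[/eqP->|im]; first by rewrite big_geq.
by rewrite big_nat_recr //= mulnDr addnAC IH // (mulnS 2 m.+1) expnD; lia.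
Qed.

(** Here v = d^3, C = c / d and 3 s_i = 4^n - 4^(i+1), so v^(s_i) = d / d^(4^(i+1)) and each term
    v^(s_i) C^(4^i) is d R^(4^i). *)
Lemma sum_vcoef_Ccoef (b : K) (e : 'I_n -> K) : b != 0 -> b != 1 ->
  \sum_(i < n) e i * vcoef 1 b ^+ sexp n i * Ccoef 1 b ^+ (2 ^ (2 * i)) =
    dcoef b * \sum_(i < n) e i * rcoef b ^+ (2 ^ (2 * i)).
Proof.
move=> b0 b1; have d0 := dcoef_neq0 b0 b1; rewrite mulr_sumr; apply: eq_bigr => i _.
rewrite mulrCA -mulrA; congr (_ * _).
have -> : vcoef 1 b = dcoef b ^+ 3 by rewrite /vcoef /dcoef !expr1n !divr1; ring.
have -> : Ccoef 1 b = ccoef b / dcoef b.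
  rewrite /Ccoef /dcoef /ccoef !expr1n !mul1r [b ^+ 4 + b]addrC.
  rewrite /dcoef in d0.
  by field.
rewrite /rcoef !expr_div_n -(exprM _ 5) (mulnC 5) exprM -(exprM _ 3).
set D := dcoef b ^+ (2 ^ (2 * i)); have D0 : D != 0 by rewrite expf_neq0.
have {2}-> : dcoef b = dcoef b ^+ (3 * sexp n i) * D ^+ 4.
  rewrite /D -exprM -exprD (_ : (2 ^ (2 * i) * 4 = 2 ^ (2 * i.+1))%N).
    by rewrite sexp3 // mul2n -addnn expnD exprM !expK_card.
  by rewrite (mulnS 2) addnC expnD.
by field.
Qed.


(** X^21 is homogeneous, so X = a x is a bijection between the solution sets. *)
Lemma nabla21_scale (a b : K) : a != 0 ->
  nabla (fun X : K => X ^+ 21) a b = #|[set x | ddiff21 x (b / a) == 0]|.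
Proof.
move=> a0; have aK : cancel (fun x : K => x * a) (fun x => x / a) by exact: mulfK.
have scale x c : a ^+ 21 * ddiff21 x c =
    (x * a + a + c * a) ^+ 21 + (x * a + c * a) ^+ 21 + (x * a + a) ^+ 21 + (x * a) ^+ 21.
  by rewrite /ddiff21 !mulrDr -!exprMn !(mulrC a) !mulrDl !mul1r.
rewrite /nabla -[RHS](card_imset _ (can_inj aK)); apply: eq_card => y; rewrite !inE.
apply/idP/imsetP => [y0|[x]].
  exists (y / a); last by rewrite divfK.
  have := scale (y / a) (b / a); rewrite !divfK // (eqP y0) => /eqP.
  by rewrite mulf_eq0 expf_eq0 (negPf a0) andbF inE.
by rewrite inE => /eqP x0 ->; rewrite -[b](divfK a0) -scale x0 mulr0.
Qed.

Lemma nabla21_degenerate (a b : K) : (a * b == 0) || (a == b) ->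
  nabla (fun X : K => X ^+ 21) a b = (2 ^ n)%N.
Proof.
move=> ab; rewrite -cardK /nabla; apply: eq_card => x; rewrite !inE; apply/eqP.
case/orP: ab => [|/eqP->].
  rewrite mulf_eq0 => /orP[] /eqP->; rewrite !addr0; first by rewrite addKK add0r addKK.
  by rewrite -addrA addKK.
by rewrite -(addrA x) addKK addr0 -(addrA (x ^+ 21)) addKK addr0 addKK.
Qed.

Lemma vcoef_scale (a b : K) : vcoef a b = vcoef 1 (b / a).
Proof. by rewrite /vcoef !expr1n !divr1 expr_div_n. Qed.

Lemma Ccoef_scale (a b : K) : a != 0 -> Ccoef a b = Ccoef 1 (b / a).
Proof.
move=> a0; have a20 : a ^+ 20 != 0 by rewrite expf_neq0.
rewrite /Ccoef !expr1n !mul1r; congr (1 + _).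
rewrite -{1 2 3 4 5 6}[b](divfK a0); move: (b / a) => c.
rewrite -[RHS]mul1r -(divff a20) mulf_div; congr (_ / _); ring.
Qed.

Lemma nabla21E (a b : K) : a != 0 -> b != 0 -> a != b ->
  nabla (fun X : K => X ^+ 21) a b =
    if (\sum_(i < n) vcoef a b ^+ sexp n i * Ccoef a b ^+ (2 ^ (2 * i)) == 0)
       && (\sum_(r < n)
             (\sum_(i < n) i.+1%:R * vcoef a b ^+ sexp n i
                             * Ccoef a b ^+ (2 ^ (2 * i))) ^+ (2 ^ (2 * r)) == 0)
    then 4%N else 0%N.
Proof.
move=> a0 b0 ab; have c0 : b / a != 0 by rewrite mulf_neq0 ?invr_neq0.
have c1 : b / a != 1 by rewrite -(divff a0) (can_eq (mulfVK a0)) // eq_sym.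
rewrite nabla21_scale // card_ddiff21 // vcoef_scale Ccoef_scale //.
move: (b / a) c0 c1 => c c0 c1; have d0 := dcoef_neq0 c0 c1.
rewrite (eq_bigr (fun i : 'I_n => 1 * vcoef 1 c ^+ sexp n i * Ccoef 1 c ^+ (2 ^ (2 * i))));
  last by move=> i _; rewrite mul1r.
rewrite !sum_vcoef_Ccoef // mulf_eq0 (negPf d0) orFb.
rewrite [X in _ = if (X == 0) && _ then _ else _](_ : _ = tr2 (rcoef c)); last first.
  by rewrite -tr4E; apply: eq_bigr => i _; rewrite mul1r.
rewrite -/(tr4 (dcoef c * _)) tr4E -/(quartic_root _).
(* Once Tr R = 0, [quartic_root] is a root W, and the second sum is Tr (d W) = Tr (b^4 R). *)
case: eqP => //= r0; rewrite tr2_mul_dcoef // quartic_rootP r0 addr0 //.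
Qed.

(** * Symmetry under the anharmonic group *)

Lemma rcoef_add1 b : rcoef (b + 1) = rcoef b.
Proof.
rewrite /rcoef /ccoef /dcoef; congr (_ / _ ^+ 5); f2ring K2 b.
Qed.

Lemma rcoef_inv b : b != 0 -> b != 1 -> rcoef b^-1 = b ^+ 4 * rcoef b.
Proof.
move=> b0 b1; have d0 := dcoef_neq0 b0 b1; rewrite /dcoef in d0.
have dv : 1 + b ^+ 3 != 0.
  apply: contraNneq d0 => dv0.
  by have -> : b + b ^+ 4 = b * (1 + b ^+ 3); [ring | rewrite dv0 mulr0].
rewrite /rcoef /ccoef /dcoef.
have -> : b + b ^+ 4 = b * (1 + b ^+ 3) by ring.
have -> : b^-1 + b^-1 ^+ 4 = (1 + b ^+ 3) / b ^+ 4 by field.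
by field; rewrite b0 dv.
Qed.

(** A representative of (1 + b^4) R modulo 1 and terms y + y^2, with the degree lowered from 18 to
    12. *)
Definition gcoef (b : K) : K := (b + 1) ^+ 12 / (b * (b ^+ 2 + b + 1) ^+ 5).

(** A root would be a primitive cube root of unity, hence a zero of b + b^4 outside {0, 1}. *)
Lemma sqrD1_neq0 (b : K) : b ^+ 2 + b + 1 != 0.
Proof.
have [->|b0] := eqVneq b 0; first by rewrite expr0n !add0r oner_eq0.
have [->|b1] := eqVneq b 1; first by rewrite expr1n addKK add0r oner_eq0.
apply: contraNneq (dcoef_neq0 b0 b1) => w0.
have -> : dcoef b = b * (b + 1) * (b ^+ 2 + b + 1) by rewrite /dcoef; f2ring K2 b.
by rewrite w0 mulr0.
Qed.

Lemma tr2_gcoef b : b != 0 -> b != 1 ->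
  tr2 ((1 + b ^+ 4) * rcoef b) = tr2 (1 + gcoef b).
Proof.
move=> b0 b1; have b10 : b + 1 != 0 by rewrite addr_eq0_pchar2.
(* The double poles of y at 0 and infinity are chosen so that y^2 + y lowers the poles of order 4 of
   (1 + b^4) R there to simple ones. *)
pose y := (1 + b + b ^+ 3 + b ^+ 4 + b ^+ 5 + b ^+ 7 + b ^+ 8)
            / (b ^+ 2 * (b ^+ 2 + b + 1) ^+ 2).
suff -> : (1 + b ^+ 4) * rcoef b = 1 + gcoef b + (y + y ^+ 2).
  by rewrite tr2D [tr2 (y + _)]tr2D tr2_sqr addKK addr0.
pose w := b ^+ 2 + b + 1; have w0 : w != 0 := sqrD1_neq0 b.
pose N := 1 + b + b ^+ 3 + b ^+ 4 + b ^+ 5 + b ^+ 7 + b ^+ 8.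
have -> : 1 + gcoef b + (y + y ^+ 2) =
    (b ^+ 4 * w ^+ 5 + (b + 1) ^+ 12 * b ^+ 3 + N * b ^+ 2 * w ^+ 3 + N ^+ 2 * w)
      / (b ^+ 4 * w ^+ 5).
  by rewrite /y /gcoef -/w -/N; field; rewrite b0 w0.
have -> : rcoef b = ccoef b / (b * (b + 1) * w) ^+ 5.
  by rewrite /rcoef; congr (_ / _ ^+ 5); rewrite /dcoef /w; f2ring K2 b.
rewrite mulrA; apply/eqP; rewrite eqr_div ?mulf_neq0 ?expf_neq0 ?mulf_neq0 //; apply/eqP.
by rewrite /ccoef /N /w; f2ring K2 b.
Qed.

Definition nondeg : {set K} := [set b | (b != 0) && (b != 1)].

Lemma card_nondeg : #|nondeg| = (2 ^ n - 2)%N.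
Proof.
have -> : nondeg = ~: [set 0; 1] by apply/setP=> b; rewrite !inE negb_or.
by rewrite cardsCs setCK cards2 eq_sym oner_eq0 cardK.
Qed.

(* The three trace conditions are permuted by the anharmonic group and pairwise
   exclusive, so each holds on at most a third of the non-degenerate elements. *)
Lemma card_tr2_gcoef_eq0 :
  (forall b, b != 0 -> b != 1 -> tr2 (rcoef b) = 0 -> tr2 (b ^+ 4 * rcoef b) = 0 -> False) ->
  (2 * (2 ^ n - 2) <= 3 * #|[set b in nondeg | tr2 (gcoef b) == 0%R]|)%N.
Proof.
move=> none.
pose S1 := [set b in nondeg | tr2 (rcoef b) == 0].
pose S2 := [set b in nondeg | tr2 (b ^+ 4 * rcoef b) == 0].
pose S3 := [set b in nondeg | tr2 ((1 + b ^+ 4) * rcoef b) == 0].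
have tr3 b : tr2 ((1 + b ^+ 4) * rcoef b) = tr2 (rcoef b) + tr2 (b ^+ 4 * rcoef b).
  by rewrite mulrDl mul1r tr2D.
have card2 : #|S2| = #|S1|.
  rewrite -(card_preimset S1 (@invr_inj K)); apply: eq_card => b; rewrite !inE.
  rewrite invr_eq0 invr_eq1; case: eqVneq => //= b0; case: eqVneq => //= b1.
  by rewrite rcoef_inv.
have card3 : #|S3| = #|S2|.
  rewrite -(card_preimset S2 (addIr (1 : K))); apply: eq_card => b; rewrite !inE.
  rewrite rcoef_add1 addr_eq0_pchar2 -[b + 1 == 1]subr_eq0 addrK.
  rewrite (frob2D 2) expr1n (addrC 1).
  by case: (b == 0); case: (b == 1).
(* Since Tr 1 = 1, the third condition holds exactly where g has trace 1. *)
have cardG : (#|S3| + #|[set b in nondeg | tr2 (gcoef b) == 0%R]| = #|nondeg|)%N.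
  rewrite -(cardsID S3 nondeg); congr (_ + _)%N; apply: eq_card => b; rewrite !inE;
    case: eqVneq => //= b0; case: eqVneq => //= b1.
  by rewrite tr2_gcoef // tr2_eq0_addr1 andbT negbK.
have disj12 : S1 :&: S2 = set0.
  apply/setP=> b; rewrite !inE; case: eqVneq => //= b0; case: eqVneq => //= b1.
  by apply/negP => /andP[/eqP r1 /eqP r2]; exact: none r1 r2.
have disj123 : (S1 :|: S2) :&: S3 = set0.
  apply/setP=> b; rewrite !inE; case: eqVneq => //= b0; case: eqVneq => //= b1.
  rewrite tr3; apply/negP => /andP[/orP[] /eqP r1]; rewrite r1 ?add0r ?addr0 => /eqP r2.
    exact: none r1 r2.
  exact: none r2 r1.
have sub : (S1 :|: S2) :|: S3 \subset nondeg.
  by rewrite !subUset -andbA; apply/and3P; split; apply/subsetP => b; rewrite !inE => /andP[].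
have := subset_leq_card sub.
rewrite cardsU disj123 cards0 cardsU disj12 cards0 -card_nondeg; lia.
Qed.

(** * Counting elements of trace zero by the polynomial method *)

Section Lacunary.

Variables (r s : nat).

(** Used with (m, l) = (Q, 1), where the monomials are distinct once s <= Q, and with (1, 2^k), the
    low-degree form of its 2^k-th power. *)
Definition lacpoly (m l : nat) (c : 'M[K]_(r, s)) : {poly K} :=
  \sum_(i < r) \sum_(j < s) c i j *: 'X^(i * m + j * l).

Lemma lacpolyD m l c e : lacpoly m l (c + e) = lacpoly m l c + lacpoly m l e.
Proof.
rewrite /lacpoly -big_split; apply: eq_bigr => i _ /=; rewrite -big_split.
by apply: eq_bigr => j _ /=; rewrite mxE scalerDl.
Qed.

Lemma size_lacpoly m l c : (size (lacpoly m l c) <= r.-1 * m + s.-1 * l + 1)%N.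
Proof.
apply: (leq_trans (size_sum _ _ _)); apply/bigmax_leqP => i _.
apply: (leq_trans (size_sum _ _ _)); apply/bigmax_leqP => j _.
apply: (leq_trans (size_scale_leq _ _)); rewrite size_polyXn addn1 ltnS.
have := ltn_ord i; have := ltn_ord j.
by case: (r) (s) i j => [|r'] [|s'] i j //=; rewrite !ltnS => ? ?; rewrite leq_add ?leq_mul.
Qed.

Lemma horner_lacpoly m l c x :
  (lacpoly m l c).[x] = \sum_(i < r) \sum_(j < s) c i j * x ^+ (i * m + j * l).
Proof.
rewrite /lacpoly horner_sum; apply: eq_bigr => i _.
by rewrite horner_sum; apply: eq_bigr => j _; rewrite hornerZ hornerXn.
Qed.

Lemma coef_lacpoly Q (c : 'M_(r, s)) t : (s <= Q)%N ->
  (lacpoly Q 1 c)`_t = \sum_(i < r) \sum_(j < s) c i j * ((t %/ Q == i) && (t %% Q == j))%N%:R.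
Proof.
move=> sQ; rewrite /lacpoly coef_sum; apply: eq_bigr => i _.
rewrite coef_sum; apply: eq_bigr => j _; rewrite coefZ coefXn; congr (_ * _%:R).
have jQ : (j < Q)%N := leq_trans (ltn_ord j) sQ.
have Q0 : (0 < Q)%N by case: Q jQ {sQ}.
rewrite muln1; congr (nat_of_bool _); apply/eqP/andP => [->|[/eqP<- /eqP<-]]; last exact: divn_eq.
by rewrite divnMDl // modnMDl divn_small // modn_small // addn0 !eqxx.
Qed.

Lemma lacpoly_eq0 Q c : (s <= Q)%N -> lacpoly Q 1 c = 0 -> c = 0.
Proof.
move=> sQ c0; apply/matrixP => i j; rewrite mxE.
have jQ : (j < Q)%N := leq_trans (ltn_ord j) sQ.
have Q0 : (0 < Q)%N by case: Q jQ {sQ c0}.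
have := coef_lacpoly c (i * Q + j) sQ; rewrite c0 coef0 => ->.
rewrite divnMDl // modnMDl divn_small // modn_small // addn0.
rewrite (bigD1 i) //= (bigD1 j) //= !eqxx mulr1 !big1 ?addr0 // => [i' i'i|j' j'j].
  have /negPf-> : (i : nat) != i' by rewrite eq_sym.
  by rewrite big1 // => j' _; rewrite mulr0.
have /negPf-> : (j : nat) != j' by rewrite eq_sym.
by rewrite mulr0.
Qed.

Lemma lacpoly_coef_neq0 Q c t : (s <= Q)%N -> (lacpoly Q 1 c)`_t != 0 -> (t %% Q < s)%N.
Proof.
move=> sQ; apply: contraR => tQ; rewrite coef_lacpoly // big1 // => i _.
rewrite big1 // => j _; suff /negPf-> : (t %% Q)%N != j by rewrite andbF mulr0.
by apply: contraNneq tQ => ->.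
Qed.

(** The source of the degree drop: the 2^k-th power turns x^(i Q) into x^i. *)
Lemma horner_lacpoly_frob k Q c x : x ^+ (Q * 2 ^ k) = x ->
  (lacpoly Q 1 c).[x] ^+ (2 ^ k) =
    (lacpoly 1 (2 ^ k) (map_mx (fun a => a ^+ (2 ^ k)) c)).[x].
Proof.
move=> xQ; rewrite !horner_lacpoly frob2_sum; apply: eq_bigr => i _.
rewrite frob2_sum; apply: eq_bigr => j _; rewrite mxE exprMn -exprM mulnDl !muln1.
by rewrite !exprD -mulnA mulnC exprM xQ.
Qed.

End Lacunary.

(** * Orders at zero and numerators of partial traces *)

Lemma order0_exists (p : {poly K}) : p != 0 ->
  exists m u, p = 'X^m * u /\ u.[0] != 0.
Proof.
move=> p0; have [m [u /implyP/(_ p0) u0 ->]] := multiplicity_XsubC p 0.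
by exists m, u; rewrite subr0 mulrC.
Qed.

Lemma order0_inj m l (u v : {poly K}) : u.[0] != 0 -> v.[0] != 0 ->
  'X^m * u = 'X^l * v -> m = l.
Proof.
have aux a b (p q : {poly K}) : p.[0] != 0 -> 'X^a * p = 'X^b * q -> (b <= a)%N.
  rewrite horner_coef0 => p0 /(congr1 (fun f : {poly K} => f`_a)).
  rewrite !coefXnM ltnn subnn; case: ltnP => // _ p0'.
  by rewrite p0' eqxx in p0.
by move=> u0 v0 E; apply/eqP; rewrite eqn_leq (aux _ _ _ _ v0 (esym E)) (aux _ _ _ _ u0 E).
Qed.

(* [gcoef b = fpoly.[b] / hpoly.[b] ^+ 2], and [gsum_num j] is the numerator of
   the sum of the [gcoef b ^+ (2 ^ i)], i < j, over the denominator [hpoly ^+ (2 ^ j)]. *)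
Definition hpoly : {poly K} := 'X * ('X^2 + 'X + 1) ^+ 3.

Definition fpoly : {poly K} := 'X * (('X + 1) ^+ 12 * ('X^2 + 'X + 1)).

Fixpoint gsum_num (j : nat) : {poly K} :=
  if j is i.+1 then hpoly ^+ (2 ^ i) * gsum_num i + fpoly ^+ (2 ^ i) else 0.

Lemma horner_hpoly b : hpoly.[b] = b * (b ^+ 2 + b + 1) ^+ 3.
Proof. by rewrite /hpoly !(hornerM, hornerD, horner_exp, hornerX, hornerC). Qed.

Lemma hpoly_neq0 b : b != 0 -> hpoly.[b] != 0.
Proof. by move=> b0; rewrite horner_hpoly mulf_neq0 ?expf_neq0 ?sqrD1_neq0. Qed.

Lemma horner_gsum_num j b : b != 0 ->
  (gsum_num j).[b] = hpoly.[b] ^+ (2 ^ j) * \sum_(i < j) gcoef b ^+ (2 ^ i).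
Proof.
move=> b0; have w0 := sqrD1_neq0 b; have h0 := hpoly_neq0 b0.
(* Over a square denominator, g^(2^i) has denominator h^(2^(i+1)), which divides h^(2^j) for i <
   j. *)
have fE : fpoly.[b] = hpoly.[b] ^+ 2 * gcoef b.
  rewrite horner_hpoly /fpoly /gcoef !(hornerM, hornerD, horner_exp, hornerX, hornerC).
  by field; rewrite b0 w0.
elim: j => [|j IH]; first by rewrite big_ord0 mulr0 horner0.
rewrite big_ord_recr /= hornerD hornerM !horner_exp IH fE expnS exprMn -exprM.
by rewrite mul2n -addnn exprD; ring.
Qed.

Lemma size_mul_bound (p q : {poly K}) a b :
  (size p <= a.+1 -> size q <= b.+1 -> size (p * q)%R <= (a + b).+1)%N.
Proof. by move=> pa qb; apply: leq_trans (size_polyMleq _ _) _; lia. Qed.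

Lemma size_exp_bound (p : {poly K}) a m :
  (size p <= a.+1 -> size (p ^+ m)%R <= (a * m).+1)%N.
Proof.
move=> pa; apply: leq_trans (size_poly_exp_leq _ _) _; rewrite ltnS leq_mul //; lia.
Qed.

Lemma size_add_bound (p q : {poly K}) a : (size p <= a -> size q <= a -> size (p + q)%R <= a)%N.
Proof. by move=> pa qa; rewrite (leq_trans (size_polyD _ _)) // geq_max pa. Qed.

Lemma size_w : (size ('X^2 + 'X + 1 : {poly K})%R <= 3)%N.
Proof. by do 2?[apply: size_add_bound]; rewrite ?size_polyXn ?size_polyX ?size_poly1. Qed.

Lemma size_hpoly : (size hpoly <= 8)%N.
Proof.
by apply: (@size_mul_bound _ _ 1 6); rewrite ?size_polyX // (size_exp_bound 3 size_w).
Qed.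

Lemma size_fpoly : (size fpoly <= 16)%N.
Proof.
apply: (@size_mul_bound _ _ 1 14); rewrite ?size_polyX //.
apply: (@size_mul_bound _ _ 12 2) size_w; apply: (@size_exp_bound _ 1 12).
by apply: size_add_bound; rewrite ?size_polyX ?size_poly1.
Qed.

(** The degree is at most 7.5 * 2^j: in the recursion 7 * 2^j + 7.5 * 2^j stays below 15 * 2^j, the
    bound for the power of f. *)
Lemma size_gsum_num j : (2 * size (gsum_num j) <= 15 * 2 ^ j + 2)%N.
Proof.
elim: j => [|j IH]; first by rewrite size_poly0.
have sh := size_exp_bound (2 ^ j) size_hpoly.
have sf := size_exp_bound (2 ^ j) size_fpoly.
suff : (size (gsum_num j.+1) <= (15 * 2 ^ j).+1)%N by rewrite expnS; lia.
apply: size_add_bound => //.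
have sP : (size (gsum_num j) <= ((15 * 2 ^ j)./2).+1)%N by lia.
by apply: leq_trans (size_mul_bound sh sP) _; lia.
Qed.

(** Both h and f have a simple zero at 0 and [gsum_num j] vanishes there, so only the power of f has
    order exactly 2^j. *)
Lemma gsum_num_order j : exists u : {poly K},
  gsum_num j.+1 = 'X^(2 ^ j) * u /\ u.[0] != 0.
Proof.
have [v Pv] : exists v, gsum_num j = 'X * v.
  elim: j => [|j [v Pv]]; first by exists 0; rewrite mulr0.
  exists (hpoly ^+ (2 ^ j) * v + 'X ^+ (2 ^ j).-1 * (('X + 1) ^+ 12 * ('X^2 + 'X + 1)) ^+ (2 ^ j)).
  rewrite /= Pv [fpoly ^+ _]exprMn -[in 'X ^+ (2 ^ j)](prednK (expn_gt0 2 j)) exprS.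
  ring.
exists (('X^2 + 'X + 1) ^+ 3 ^+ (2 ^ j) * ('X * v) + (('X + 1) ^+ 12 * ('X^2 + 'X + 1)) ^+ (2 ^ j)).
split; first by rewrite /= Pv !exprMn; ring.
rewrite !(hornerM, hornerD, horner_exp, hornerX, hornerC).
by rewrite !(mul0r, mulr0, add0r, addr0, expr0n, expr1n, mulr1) oner_eq0.
Qed.

(** There are r (s + t) coefficients and N conditions. The map is additive but not linear, because
    of the Frobenius on the coefficients, so two colliding inputs are added instead of taking a
    kernel vector. *)
Lemma auxiliary_coefs (r s t m N : nat) (P : {poly K}) :
  (N < r * (s + t))%N ->
  (r.-1 + s.-1 * 2 ^ m < N)%N -> (r.-1 + t.-1 * 2 ^ m + size P <= N)%N ->
  exists c : 'M[K]_(r, s), exists e : 'M[K]_(r, t),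
    ((c != 0) || (e != 0)) /\
    lacpoly 1 (2 ^ m) (map_mx (fun a => a ^+ (2 ^ m)) c) +
      P * lacpoly 1 (2 ^ m) (map_mx (fun a => a ^+ (2 ^ m)) e) = 0.
Proof.
move=> Nrst sN tN.
pose fr r s (c : 'M[K]_(r, s)) := map_mx (fun a => a ^+ (2 ^ m)) c.
have frD r' s' (c c' : 'M[K]_(r', s')) : fr _ _ (c + c') = fr _ _ c + fr _ _ c'.
  by apply/matrixP=> i j; rewrite !mxE frob2D.
pose Phi (ce : 'M[K]_(r, s) * 'M[K]_(r, t)) : {poly K} :=
  lacpoly 1 (2 ^ m) (fr _ _ ce.1) + P * lacpoly 1 (2 ^ m) (fr _ _ ce.2).
have PhiD x y : Phi x + Phi y = Phi (x.1 + y.1, x.2 + y.2).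
  by rewrite /Phi !frD !lacpolyD; ring.
have size_Phi x : (size (Phi x) <= N)%N.
  apply: size_add_bound; first by apply: leq_trans (size_lacpoly _ _ _) _; lia.
  apply: leq_trans (size_polyMleq _ _) _.
  have := size_lacpoly 1 (2 ^ m) (fr _ _ x.2); lia.
have : ~~ injectiveb (fun x => poly_rV (Phi x) : 'rV[K]_N).
  have K1 : (1 < #|K|)%N by rewrite cardK -[1%N](expn0 2) ltn_exp2l.
  apply/negP => /injectiveP/leq_card; apply/negP; rewrite -ltnNge card_prod.
  rewrite !card_mx; move: #|K| K1 => q q1.
  by rewrite -expnD -mulnDr mul1n ltn_exp2l.
case/injectivePn => x [y xy /(congr1 (@rVpoly _ _))]; rewrite !poly_rV_K // => E.
exists (x.1 + y.1), (x.2 + y.2); split.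
  rewrite -negb_and; apply: contra xy => /andP[].
  have mxc r' s' (c c' : 'M[K]_(r', s')) : c + c' == 0 -> c = c'.
    move=> /eqP/matrixP cc; apply/matrixP => i j; apply/eqP.
    by rewrite -addr_eq0_pchar2; have := cc i j; rewrite !mxE => ->.
  by case: x y E => [c e] [c' e'] _ /= /mxc-> /mxc->.
have := PhiD x y; rewrite /Phi /= => <-; rewrite -/(Phi x) -/(Phi y) E.
by rewrite (addrr_pchar2 (_ : 2 \in [pchar {poly K}])) // pchar_poly.
Qed.

(* At 0 the first summand has order in [-1, s - 1) modulo 2^(k+1), the second
   one in [2^k, 2^k + t), so they cannot cancel. *)
Lemma auxiliary_poly_neq0 r s t k c e : (s < 2 ^ k)%N -> (t < 2 ^ k)%N ->
  (c != 0 :> 'M[K]_(r, s)) || (e != 0 :> 'M[K]_(r, t)) ->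
  hpoly ^+ (2 ^ k.+1).-1 * lacpoly (2 ^ k.+1) 1 c
    + gsum_num k.+1 * lacpoly (2 ^ k.+1) 1 e != 0.
Proof.
move=> sQ tQ ce; apply/negP => /eqP; set C := lacpoly _ _ c; set E := lacpoly _ _ e.
have sQ2 : (s <= 2 ^ k.+1)%N by rewrite expnS; lia.
have tQ2 : (t <= 2 ^ k.+1)%N by rewrite expnS; lia.
have [u [Pu u0]] := gsum_num_order k.
have u_neq0 : u != 0 by apply: contraNneq u0 => ->; rewrite horner0.
rewrite Pu; have [/eqP C0|C0] := eqVneq C 0.
  rewrite (eqP C0) mulr0 add0r => /eqP; rewrite !mulf_eq0 expf_eq0 polyX_eq0 andbF /=.
  rewrite (negPf u_neq0) /= => /eqP/lacpoly_eq0 e0.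
  move: C0 => /eqP/lacpoly_eq0 c0.
  by rewrite c0 // e0 // !eqxx in ce.
have [m1 [v [Cv v0]]] := order0_exists C0.
have [/eqP E0|E0] := eqVneq E 0.
  rewrite (eqP E0) mulr0 addr0 => /eqP; rewrite mulf_eq0 (negPf C0) orbF expf_eq0.
  case/andP=> _ /eqP/(congr1 (fun p : {poly K} => p.[1])); rewrite horner0 => /eqP.
  by rewrite (negPf (hpoly_neq0 (oner_neq0 _))).
have [m2 [w [Ew w0]]] := order0_exists E0.
have lowcoef m (p q : {poly K}) : p = 'X^m * q -> q.[0] != 0 -> p`_m != 0.
  by move=> ->; rewrite coefXnM ltnn subnn horner_coef0.
have m1s := lacpoly_coef_neq0 sQ2 (lowcoef _ _ _ Cv v0).
have m2t := lacpoly_coef_neq0 tQ2 (lowcoef _ _ _ Ew w0).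
rewrite Cv Ew exprMn => /eqP; rewrite addr_eq0 => /eqP ord.
have : 'X^((2 ^ k.+1).-1 + m1) * ((('X^2 + 'X + 1) ^+ 3) ^+ (2 ^ k.+1).-1 * v)
     = 'X^(2 ^ k + m2) * - (u * w) :> {poly K}.
  rewrite !exprD.
  transitivity ('X ^+ (2 ^ k.+1).-1 * ('X^2 + 'X + 1) ^+ 3 ^+ (2 ^ k.+1).-1 * ('X^m1 * v)).
    by ring.
  by rewrite ord; ring.
move/order0_inj => /(_ _ _) eqm.
have {eqm} : ((2 ^ k.+1).-1 + m1 = 2 ^ k + m2)%N.
  apply: eqm; last by rewrite hornerN oppr_eq0 hornerM mulf_neq0.
  rewrite hornerM mulf_neq0 // !(hornerD, horner_exp, hornerX, hornerC).
  by rewrite expr0n !add0r !expr1n oner_neq0.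
rewrite (divn_eq m1 (2 ^ k.+1)) (divn_eq m2 (2 ^ k.+1)).
move: (m1 %% _)%N (m1 %/ _)%N m1s (m2 %% _)%N (m2 %/ _)%N m2t => r1 a r1s r2 b r2t.
rewrite expnS; move: (2 ^ k)%N sQ tQ => H sH tH.
case: (leqP b a) => ab; have := leq_mul ab (leqnn (2 * H)); rewrite ?mulSn;
  by move: (a * (2 * H))%N (b * (2 * H))%N => aQ bQ; clear -r1s r2t sH tH; lia.
Qed.

(* If the trace of g = [gcoef b] vanishes, the sum of the g^(2^i), i < k, is the
   2^k-th power of the sum of the g^(2^i), i < m. *)
Lemma auxiliary_poly_root m k r s t (c : 'M[K]_(r, s)) (e : 'M[K]_(r, t)) b : (k + m = n)%N ->
  lacpoly 1 (2 ^ m) (map_mx (fun a => a ^+ (2 ^ m)) c)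
    + gsum_num m * lacpoly 1 (2 ^ m) (map_mx (fun a => a ^+ (2 ^ m)) e) = 0 ->
  b != 0 -> tr2 (gcoef b) = 0 ->
  root (hpoly ^+ (2 ^ k).-1 * lacpoly (2 ^ k) 1 c
         + gsum_num k * lacpoly (2 ^ k) 1 e) b.
Proof.
move=> kmn ce0 b0 trb0; apply/rootP.
pose S j := \sum_(i < j) gcoef b ^+ (2 ^ i).
have SkE : S k = S m ^+ (2 ^ k).
  apply/eqP; rewrite -addr_eq0_pchar2 -trb0 /tr2 -kmn big_split_ord; apply/eqP.
  congr (_ + _); rewrite frob2_sum; apply: eq_bigr => i _.
  by rewrite -exprM -expnD addnC.
have xQM (x : K) : x ^+ (2 ^ k * 2 ^ m) = x by rewrite -expnD kmn expK_card.
rewrite hornerD !hornerM horner_exp horner_gsum_num // -/(S k) SkE.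
set h := hpoly.[b]; set C := (lacpoly _ _ c).[b]; set E := (lacpoly _ _ e).[b].
have -> : h ^+ (2 ^ k).-1 * C + h ^+ (2 ^ k) * S m ^+ (2 ^ k) * E =
          h ^+ (2 ^ k).-1 * (C + h * S m ^+ (2 ^ k) * E).
  by rewrite -[in h ^+ (2 ^ k)](prednK (expn_gt0 2 k)) exprS; ring.
apply/eqP; rewrite mulf_eq0; apply/orP; right.
(* The 2^m-th power restores S m, as (S m)^(2^n) = S m; then h^(2^m) S m is the value of
   [gsum_num m], and the relation [ce0] applies. *)
have [_ <-] : (0 < 2 ^ m)%N /\ ((C + h * S m ^+ (2 ^ k) * E) ^+ (2 ^ m) == 0) =
   (C + h * S m ^+ (2 ^ k) * E == 0) by rewrite expf_eq0 expn_gt0.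
rewrite frob2D !exprMn -exprM xQM /C /E !horner_lacpoly_frob // -horner_gsum_num //.
by rewrite -hornerM -hornerD ce0 horner0.
Qed.

Lemma card_tr2_gcoef_lt : (13 <= n)%N ->
  (3 * #|[set b in nondeg | tr2 (gcoef b) == 0%R]| < 2 * (2 ^ n - 2))%N.
Proof.
move=> n13; pose k := (n - 8)%N; have kn : (k.+1 + 7 = n)%N by rewrite /k; lia.
have H32 : (32 <= 2 ^ k)%N by rewrite -[32%N]/(2 ^ 5)%N leq_exp2l // /k; lia.
have s7 : (size (gsum_num 7) <= 961)%N.
  by have := size_gsum_num 7; rewrite -[(2 ^ 7)%N]/128%N; lia.
(* 78 * (23 + 15) = 2964 coefficients exceed 2894 = 77 + 22 * 128 + 1, the size bound of the first
   summand; the second has at most 77 + 14 * 128 + 961. Both 23 and 15 are below 2^k >= 32. *)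
have [|||c [e [ce0 ceE]]] := @auxiliary_coefs 78 23 15 7 2894 (gsum_num 7).
- by [].
- by [].
- by apply: (@leq_trans (77 + 14 * 128 + 961)); rewrite // leq_add2l.
pose B := hpoly ^+ (2 ^ k.+1).-1 * lacpoly (2 ^ k.+1) 1 c
            + gsum_num k.+1 * lacpoly (2 ^ k.+1) 1 e.
have B0 : B != 0 by apply: auxiliary_poly_neq0 => //; lia.
(* With Q = 2^(k+1) the summands have degrees at most 84 Q + 15 and 84.5 Q + 14. *)
have size_B : (2 * size B <= 169 * 2 ^ k.+1 + 30)%N.
  have sB : (size B <= (169 * 2 ^ k + 15))%N.
    have QE : (2 ^ k.+1 = 2 * 2 ^ k)%N by rewrite expnS.
    apply: size_add_bound.
      have sh := size_exp_bound (2 ^ k.+1).-1 size_hpoly.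
      apply: leq_trans (size_mul_bound sh (b := (77 * 2 ^ k.+1 + 22)%N) _) _.
        by apply: leq_trans (size_lacpoly _ _ _) _; lia.
      lia.
    have sP : (size (gsum_num k.+1) <= (15 * 2 ^ k).+1)%N.
      by have := size_gsum_num k.+1; lia.
    apply: leq_trans (size_mul_bound sP (b := (77 * 2 ^ k.+1 + 14)%N) _) _.
      by apply: leq_trans (size_lacpoly _ _ _) _; lia.
    lia.
  by rewrite expnS; lia.
have := @max_poly_roots _ B (enum [set b in nondeg | tr2 (gcoef b) == 0%R]) B0.
rewrite enum_uniq -cardE => /(_ _ isT) cardG.
have {}cardG : (#|[set b in nondeg | tr2 (gcoef b) == 0%R]| < size B)%N.
  apply: cardG; apply/allP => b; rewrite mem_enum !inE => /andP[/andP[b0 _] /eqP trb0].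
  exact: auxiliary_poly_root kn ceE b0 trb0.
have -> : (2 ^ n = 128 * 2 ^ k.+1)%N by rewrite -kn expnD mulnC.
by rewrite expnS in size_B *; lia.
Qed.

End OddDegree.

(** * Explicit solutions in small degrees *)

Fixpoint f2bits (s : seq bool) : f2expr :=
  if s is a :: s' then F2add (if a then F2one else F2zero) (F2mul F2X (f2bits s'))
  else F2zero.

(* Long division; here [p] and [s] list their coefficients from the highest
   degree down, and [p] lacks its leading coefficient. *)
Fixpoint bits_quo (k : nat) (p s : seq bool) : seq bool :=
  match k, s with
  | k'.+1, a :: s' => a :: bits_quo k' p (if a then bits_add p s' else s')
  | _, _ => [::]
  end.

Definition bits_div (s p : seq bool) : seq bool :=
  rev (bits_quo (size s - (size p).-1) (behead (rev p)) (rev s)).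

Definition bits_dvd (p s : seq bool) : bool :=
  ~~ has id (bits_add s (bits_mul p (bits_div s p))).

Definition f2ddiff21 (x : f2expr) : f2expr :=
  F2add (F2add (F2add (F2exp (F2add (F2add x F2one) F2X) 21) (F2exp (F2add x F2X) 21))
               (F2exp (F2add x F2one) 21)) (F2exp x 21).

Definition bits_frob (n : nat) : seq bool :=
  bits_add [:: false; true] (rcons (nseq (2 ^ n) false) true).

(* [p] is the minimal polynomial over F_2 of some [b], and [x] is a solution
   written in powers of [b]. *)
Definition witness_check (n : nat) (p x : seq bool) : bool :=
  let q := bits_div (bits_frob n) p in
  [&& nth false p 0, odd (count id p), has id q, (size q <= 2 ^ n)%N,
      bits_dvd p (bits_frob n) & bits_dvd p (f2norm (f2ddiff21 (f2bits x)))].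

Section Witness.

Variables (n : nat) (K : finFieldType).
Hypothesis cardK : #|K| = (2 ^ n)%N.

Let K2 : 2 \in [pchar K]. Proof. exact: pchar2K cardK. Qed.

Lemma bits_dvd_eval p s (b : K) :
  bits_dvd p s -> bits_eval b s = bits_eval b p * bits_eval b (bits_div s p).
Proof.
move=> /(bits_eval0 b); rewrite bits_evalD // bits_evalM // => /eqP.
by rewrite addr_eq0 (oppr_pchar2 K2) => /eqP.
Qed.

Lemma bits_eval_frob (b : K) : bits_eval b (bits_frob n) = 0.
Proof.
rewrite /bits_frob bits_evalD //= mulr0 addr0 mulr1 add0r.
have -> : bits_eval b (rcons (nseq (2 ^ n) false) true) = b ^+ (2 ^ n).
  elim: (2 ^ n)%N => [|k IH] /=; first by rewrite mulr0 addr0.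
  by rewrite IH add0r exprS.
by rewrite -cardK expf_card (addrr_pchar2 K2).
Qed.

Lemma horner_bits (s : seq bool) (b : K) :
  (Poly [seq (nat_of_bool a)%:R | a <- s]).[b] = bits_eval b s.
Proof.
rewrite horner_Poly; elim: s => //= a s ->.
by rewrite addrC mulrC.
Qed.

(** p q = X^(2^n) + X vanishes on the whole field; without a root of p, the nonzero q of degree
    below 2^n would have 2^n roots. Irreducibility of p is never tested. *)
Lemma bits_root_exists p (q := bits_div (bits_frob n) p) :
  has id q -> (size q <= 2 ^ n)%N -> bits_dvd p (bits_frob n) ->
  exists b : K, bits_eval b p = 0.
Proof.
move=> q0 sq dvd; pose Q : {poly K} := Poly [seq (nat_of_bool a)%:R | a <- q].
have Q0 : Q != 0.
  apply: contraTneq q0 => Q0; apply/hasPn => a /(nthP false)[i iq <-].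
  have := congr1 (fun f : {poly K} => f`_i) Q0.
  rewrite coef0 coef_Poly (nth_map false) //; case: nth => //= /eqP.
  by rewrite oner_eq0.
case: (pickP (fun b : K => bits_eval b p == 0)) => [b /eqP b0|none]; first by exists b.
have rootsQ : all (root Q) (enum K).
  apply/allP => b _; apply/rootP; rewrite horner_bits.
  have := bits_dvd_eval b dvd; rewrite bits_eval_frob => /esym/eqP.
  by rewrite mulf_eq0 none => /eqP.
have := max_poly_roots Q0 rootsQ (enum_uniq _).
by rewrite -cardE cardK ltnNge (leq_trans (size_Poly _)) ?size_map.
Qed.

(** A nonzero constant term and an odd number of terms give p(0) = p(1) = 1, so a root b of p is
    neither 0 nor 1. *)
Lemma witness_exists p x : witness_check n p x ->
  exists b : K, [/\ b != 0, b != 1 & exists y, ddiff21 y b = 0].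
Proof.
case/andP => p0 /and5P[p1 q0 sq dvdp dvdx]; have [b pb] := bits_root_exists q0 sq dvdp.
exists b; split.
- apply: contraTneq p0 => b0; move: pb; rewrite b0.
  by case: (p) => //= -[] //= s /eqP; rewrite mul0r addr0 oner_eq0.
- apply: contraTneq p1 => b1; move: pb; rewrite b1.
  have -> s : bits_eval 1 s = (count id s)%:R :> K.
    by elim: s => //= a s ->; rewrite mul1r natrD.
  by rewrite (natrK_odd cardK); case: odd => //= /eqP; rewrite oner_eq0.
- exists (f2eval b (f2bits x)); have := bits_dvd_eval b dvdx.
  by rewrite pb mul0r f2normE.
Qed.

End Witness.

Lemma small_solution_exists (n : nat) (K : finFieldType) : n \in [:: 3; 7; 9; 11] ->
  #|K| = (2 ^ n)%N ->
  exists b : K, [/\ b != 0, b != 1 & exists y, ddiff21 y b = 0].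
Proof.
(* Here b is a root of 1 + X + X^3 and the solution is b^2; the other degrees are read the same
   way. *)
have w3 : witness_check 3 [:: true; true; false; true] [:: false; false; true].
  by vm_compute.
have w7 : witness_check 7 [:: true; false; false; true; false; false; false; true]
  [:: false; false; true; true; false; false; true].
  by vm_compute.
have w9 : witness_check 9
  [:: true; true; false; false; false; false; false; false; false; true]
  [:: false; false; true; true; false; false; true; false; true].
  by vm_compute.
have w11 : witness_check 11
  [:: true; true; false; true; false; true; false; false; false; false; false; true]
  [:: false; false; true; false; false; false; true; false; false; false; true].
  by vm_compute.
rewrite !inE => /or4P[] /eqP-> cardK.
- exact: (witness_exists cardK w3).
- exact: (witness_exists cardK w7).
- exact: (witness_exists cardK w9).
- exact: (witness_exists cardK w11).
Qed.

(** * Existence of solutions and the maximum *)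

Lemma solution_exists (n : nat) (K : finFieldType) : odd n -> #|K| = (2 ^ n)%N ->
  n != 1%N -> n != 5%N ->
  exists b : K, [/\ b != 0, b != 1 & exists y, ddiff21 y b = 0].
Proof.
move=> n_odd cardK n1 n5; have [n13|n13] := leqP 13 n; last first.
  apply: small_solution_exists cardK; rewrite !inE.
  by move: n_odd n1 n5 n13; do 13?[case: n => [|n] //].
case: (pickP (fun b : K => [&& b != 0, b != 1, tr2 n (rcoef b) == 0
                              & tr2 n (b ^+ 4 * rcoef b) == 0])) => [b|none].
  case/and4P=> b0 b1 /eqP r0 /eqP br0; exists b; split=> //.
  exact: (ddiff21_solvable n_odd cardK b0 b1).2.
(* If no b met both conditions, trace 0 of g on two thirds of the b would exceed the polynomial
   bound. *)
have := card_tr2_gcoef_lt n_odd cardK n13; rewrite ltnNge card_tr2_gcoef_eq0 // => b b0 b1 r0 br0.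
by have := none b; rewrite b0 b1 r0 br0 !eqxx.
Qed.

Theorem theorem4p1 (n : nat) (K : finFieldType)
    (n_odd : odd n) (cardK : #|K| = (2 ^ n)%N) :
  (forall a b : K,
     nabla (fun X : K => X ^+ 21) a b =
       if (a * b == 0) || (a == b) then (2 ^ n)%N
       else if (\sum_(i < n) vcoef a b ^+ sexp n i
                               * Ccoef a b ^+ (2 ^ (2 * i)) == 0)
            && (\sum_(r < n)
                  (\sum_(i < n) i.+1%:R * vcoef a b ^+ sexp n i
                                  * Ccoef a b ^+ (2 ^ (2 * i)))
                    ^+ (2 ^ (2 * r)) == 0)
       then 4%N
       else 0%N)
  /\ (n != 1%N -> n != 5%N ->
        feistel_boomerang_uniformity (fun X : K => X ^+ 21) = 4%N).
Proof.
split=> [a b|n1 n5].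
  case: ifPn => [|]; first exact: nabla21_degenerate.
  rewrite negb_or mulf_eq0 negb_or => /andP[/andP[a0 b0] ab].
  exact: nabla21E.
apply/eqP; rewrite eqn_leq; apply/andP; split.
  apply/bigmax_leqP => -[a b] /= /and3P[a0 b0 ab].
  by rewrite (nabla21E n_odd cardK a0 b0 ab); case: ifP.
have [b [b0 b1 [y yb0]]] := solution_exists n_odd cardK n1 n5.
have [|r0 br0] := (ddiff21_solvable n_odd cardK b0 b1).1; first by exists y.
apply: leq_trans (leq_bigmax_cond (1, b) _); last by rewrite /= oner_eq0 b0 eq_sym b1.
rewrite /= nabla21_scale ?oner_eq0 // divr1 (card_ddiff21 n_odd cardK b0 b1).
by rewrite r0 br0 eqxx.
Qed.
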